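(* Let $X$ and $Y$ be real analytic orbifolds and let $f\colon X\to Y$ be a subanalytic map. If $B$ is a subanalytic subset of $Y$, then $f^{-1}(B)$ is a subanalytic subset of $X$. If, in addition, $f$ is a proper map, then the image $f(A)$ of any subanalytic subset $A$ of $X$ is subanalytic in $Y$.
   Context: Orbifolds. Let $X$ be a topological space and $n>0$. An $n$-dimensional orbifold chart for an open subset $V$ of $X$ is a triple $(\tilde V,G,\varphi)$ where $\tilde V$ is a connected open subset of $\mathbb{R}^n$, $G$ is a finite group acting on $\tilde V$ by homeomorphisms (not necessarily effectively; $\ker(G)$ denotes the subgroup acting trivially), and $\varphi\colon\tilde V\to V$ is a $G$-invariant map inducing a homeomorphism $\tilde V/G\to V$. If $V_i\subset V_j$, an embedding $(\lambda_{ij},h_{ij})\colon(\tilde V_i,G_i,\varphi_i)\to(\tilde V_j,G_j,\varphi_j)$ consists of an injective homomorphism $h_{ij}\colon G_i\to G_j$ that restricts to an isomorphism $\ker(G_i)\to\ker(G_j)$, and a topological embedding $\lambda_{ij}\colon\tilde V_i\to\tilde V_j$ with $\lambda_{ij}(gx)=h_{ij}(g)\lambda_{ij}(x)$ for all $g\in G_i$, $x\in\tilde V_i$, and $\varphi_j\circ\lambda_{ij}=\varphi_i$. An orbifold atlas on $X$ is a family of orbifold charts $\{(\tilde V_i,G_i,\varphi_i)\}_{i\in I}$ such that the $V_i=\varphi_i(\tilde V_i)$ cover $X$ and such that for any two charts and any $x\in V_i\cap V_j$ there are an open neighborhood $V_k\subset V_i\cap V_j$ of $x$ and a chart of the family for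 $V_k$ which has embeddings into both given charts. An atlas refines another if each of its charts embeds into some chart of the other; two atlases are equivalent if they have a common refinement. An $n$-dimensional orbifold is a paracompact Hausdorff space with an equivalence class of $n$-dimensional orbifold atlases (equivalently, a maximal atlas); orbifolds are assumed to have only countably many connected components. It is real analytic if all chart groups act by real analytic diffeomorphisms and all embeddings $\lambda_{ij}$ are real analytic. An orbifold chart of $X$ means a chart of the maximal real analytic atlas. Subanalytic sets in manifolds. Let $M$ be a real analytic manifold. For $U\subset M$ open, $S(C^\omega(U))$ is the smallest family of subsets of $U$ containing all sets $\{x\in U\mid f(x)>0\}$, $f\colon U\to\mathbb{R}$ real analytic, and stable under finite intersections, finite unions and complements. A set $A\subset M$ is semianalytic if every $x\in M$ has an (open) neighborhood $U$ with $A\cap U\in S(C^\omega(U))$. A set $A\subset M$ is subanalytic if every $x\in M$ has a neighborhood $U$ for which there are a real analytic manifold $N$ and a relatively compact (i.e. with compact closure) semianalytic subset $B$ of $M\times N$ with $A\cap U=p(B)$, where $p\colon M\times N\to M$ is the projection. A continuous map between real analytic manifolds $M\to N$ is subanalytic if its graph is a subanalytic subset of $M\times N$. Subanalytic sets and maps for orbifolds. A subset $A$ of a real analytic orbifold $X$ is subanalytic if for every $x\in X$ there is an orbifold chart $(\tilde V,G,\varphi)$ of $X$ with $x\in V=\varphi(\tilde V)$ such that $\varphi^{-1}(A\cap V)$ is a subanalytic subset of $\tilde V$. A map $f\colon X\to Y$ between real analytic orbifolds is subanalytic if for every $x\in X$ there are orbifold charts $(\tilde U,G,\varphi)$ of $X$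 and $(\tilde V,H,\psi)$ of $Y$ with $x\in U=\varphi(\tilde U)$, $f(x)\in V=\psi(\tilde V)$, $f(U)\subset V$, a homomorphism $\theta\colon G\to H$, and a subanalytic map $\tilde f\colon\tilde U\to\tilde V$ that is $\theta$-equivariant ($\tilde f(gz)=\theta(g)\tilde f(z)$) and satisfies $\psi\circ\tilde f=f\circ\varphi$. A map is proper if inverse images of compact sets are compact. *)

(* Defs.v *)
From HB Require Import structures.
From mathcomp Require Import all_boot all_order all_algebra all_fingroup.
From mathcomp.analysis.showcase Require Import summability.
From mathcomp Require Import all_classical all_reals all_analysis.

Set Implicit Arguments.
Unset Strict Implicit.
Unset Printing Implicit Defensive.

Import Order.TTheory GRing.Theory Num.Theory.
Import numFieldNormedType.Exports.

Local Open Scope classical_set_scope.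
Local Open Scope ring_scope.

Section AnalyticFunctions.
Context {R : realType}.

(* Near [x], [f] is the (unconditionally convergent) sum of a power series,
   indexed by the multi-indices [a : {ffun 'I_n -> nat}]. *)
Definition analytic_at n (x : 'rV[R]_n) (f : 'rV[R]_n -> R) : Prop :=
  exists c : {ffun 'I_n -> nat} -> R, nbhs x [set y : 'rV[R]_n |
    partial_sum (fun a : {ffun 'I_n -> nat} =>
      c a * \prod_(i < n) (y 0 i - x 0 i) ^+ a i) @ totally --> f y].

Definition analytic_on n m (S : set 'rV[R]_n) (f : 'rV[R]_n -> 'rV[R]_m) :
    Prop :=
  forall x, S x -> forall i, analytic_at x (fun y => f y 0 i).

(* Maps between subsets of Euclidean spaces, seen as types; the total function
   [g] is only a representative of [f], its values off [V] are irrelevant. *)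
Definition analytic_map n m (V : set 'rV[R]_n) (W : set 'rV[R]_m) (f : V -> W) :
    Prop :=
  exists2 g : 'rV[R]_n -> 'rV[R]_m,
    analytic_on V g & forall x : V, g (set_val x) = set_val (f x).

End AnalyticFunctions.

Record mchart (R : realType) (T : topologicalType) (n : nat) := MChart {
  mdom : set T;
  mmap : T -> 'rV[R]_n }.

(* The data of a manifold; the axioms are [is_manifold] below. *)
Record manifold_data (R : realType) := Manifold {
  mspace :> topologicalType;
  mdim : nat;
  matlas : set (mchart R mspace mdim) }.

Arguments matlas {R} M : rename.

Section Manifolds.
Context {R : realType}.

(* [mmap c] is a homeomorphism from the open set [mdom c] onto an open set. *)
Definition is_mchart (T : topologicalType) n (c : mchart R T n) : Prop :=
  [/\ open (mdom c),
      {within mdom c, continuous (mmap c)},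
      (forall x y, mdom c x -> mdom c y -> mmap c x = mmap c y -> x = y) &
      forall O : set T, open O -> O `<=` mdom c -> open (mmap c @` O)].

(* The transition map [mmap d \o (mmap c)^-1] is analytic. *)
Definition analytic_transition (T : topologicalType) n (c d : mchart R T n) :
    Prop :=
  exists2 t : 'rV[R]_n -> 'rV[R]_n,
    analytic_on (mmap c @` (mdom c `&` mdom d)) t &
    forall x, mdom c x -> mdom d x -> t (mmap c x) = mmap d x.

Definition is_manifold (M : manifold_data R) : Prop :=
  [/\ hausdorff_space M,
      @second_countable M,
      (forall c, matlas M c -> is_mchart c),
      (forall x : M, exists2 c, matlas M c & mdom c x) &
      forall c d, matlas M c -> matlas M d -> analytic_transition c d].

Definition open_manifold n (V : set 'rV[R]_n) : manifold_data R :=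
  @Manifold R V n [set MChart setT set_val].

Definition prod_manifold (M N : manifold_data R) : manifold_data R :=
  @Manifold R (M * N)%type (mdim M + mdim N)
    [set e | exists c d, [/\ matlas M c, matlas N d &
       e = MChart (mdom c `*` mdom d)
                  (fun p => row_mx (mmap c p.1) (mmap d p.2))]].

(* [f] is real analytic on the open set [U]: in each chart [c] of the atlas,
   [f \o (mmap c)^-1] is analytic. Only the values of [f] on [U] matter. *)
Definition analytic_function (M : manifold_data R) (U : set M) (f : M -> R) :
    Prop :=
  forall c, matlas M c -> exists2 g : 'rV[R]_(mdim M) -> R,
    (forall x, mdom c x -> U x -> analytic_at (mmap c x) g) &
    forall x, mdom c x -> U x -> g (mmap c x) = f x.

(* The family S(C^omega(U)). *)
Inductive analytic_algebra (M : manifold_data R) (U : set M) : set M -> Prop :=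
| algebra_pos f of analytic_function U f :
    analytic_algebra U [set x | U x /\ 0 < f x]
| algebra_setI A B of analytic_algebra U A & analytic_algebra U B :
    analytic_algebra U (A `&` B)
| algebra_setU A B of analytic_algebra U A & analytic_algebra U B :
    analytic_algebra U (A `|` B)
| algebra_setD A of analytic_algebra U A :
    analytic_algebra U (U `\` A).

Definition semianalytic (M : manifold_data R) (A : set M) : Prop :=
  forall x : M, exists U : set M,
    [/\ open U, U x & analytic_algebra U (A `&` U)].

Definition subanalytic (M : manifold_data R) (A : set M) : Prop :=
  forall x : M, exists2 U : set M, nbhs x U &
    exists (N : manifold_data R) (B : set (prod_manifold M N)),
      [/\ is_manifold N, semianalytic B, compact (closure B) &
          A `&` U = fst @` B].

Definition subanalytic_map (M N : manifold_data R) (f : M -> N) : Prop :=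
  continuous f /\
  @subanalytic (prod_manifold M N) [set p | p.2 = f p.1].

End Manifolds.

(* The chart of the open set [V = range oproj] of [X]. [oproj_orbit] and
   [oproj_quotient] say that [oproj] induces a bijection from the set of orbits
   onto [V], and that this bijection identifies the quotient topology with the
   topology of [V]. *)
Record ochart (R : realType) (X : topologicalType) (n : nat) := OChart {
  odom : set 'rV[R]_n;
  ogroup : finGroupType;
  oact : ogroup -> odom -> odom;
  oproj : odom -> X;
  odom_open : open odom;
  odom_connected : connected odom;
  oact1 : forall z, oact 1%g z = z;
  oactM : forall a b z, oact (a * b)%g z = oact a (oact b z);
  oact_continuous : forall a, continuous (oact a);
  oproj_open : open (range oproj);
  oproj_orbit : forall z w, oproj z = oproj w <-> exists a, w = oact a z;
  oproj_quotient : forall O : set X, O `<=` range oproj ->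
    (open O <-> open (oproj @^-1` O)) }.

(* Not [set (ochart R X n)]: for universe reasons, [set] does not apply to a
   type of structures over all [finGroupType]s. *)
Definition ochart_family (R : realType) (X : topologicalType) (n : nat) :=
  ochart R X n -> Prop.

Section Charts.
Context {R : realType} {X : topologicalType} {n : nat}.
Implicit Types c d k : ochart R X n.

Definition oimage c : set X := range (@oproj _ _ _ c).

Definition okernel c : {set ogroup c} :=
  [set a | `[< forall z, oact a z = z >]]%SET.

Definition topological_embedding (S T : topologicalType) (l : S -> T) : Prop :=
  [/\ continuous l, injective l &
      forall O, open O -> exists2 O', open O' & O = l @^-1` O'].

Definition ochart_embedding c d (l : odom c -> odom d)
    (h : ogroup c -> ogroup d) : Prop :=
  [/\ {morph h : a b / (a * b)%g} /\ injective h,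
      isom (okernel c) (okernel d) h,
      topological_embedding l,
      (forall a z, l (oact a z) = oact (h a) (l z)) &
      forall z, oproj (l z) = oproj z].

(* A real analytic embedding of equidimensional manifolds: an analytic
   diffeomorphism onto an open subset. *)
Definition analytic_embedding (V W : set 'rV[R]_n) (l : V -> W) : Prop :=
  [/\ analytic_map l, open (range l) &
      exists2 g : 'rV[R]_n -> 'rV[R]_n,
        analytic_on (range (set_val \o l)) g &
        forall x : V, g (set_val (l x)) = set_val x].

Definition embeds c d : Prop :=
  exists (l : odom c -> odom d) (h : ogroup c -> ogroup d),
    ochart_embedding l h /\ analytic_embedding l.

Definition analytic_atlas (A : ochart_family R X n) : Prop :=
  [/\ (forall c, A c -> forall a, analytic_map (@oact _ _ _ c a)),
      (forall x, exists2 c, A c & oimage c x) &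
      forall c d x, A c -> A d -> oimage c x -> oimage d x ->
        exists k, [/\ A k, oimage k x, oimage k `<=` oimage c `&` oimage d,
                      embeds k c & embeds k d]].

Definition refines (A B : ochart_family R X n) : Prop :=
  forall c, A c -> exists2 d, B d & embeds c d.

Definition equivalent_atlases (A B : ochart_family R X n) : Prop :=
  exists C, [/\ analytic_atlas C, refines C A & refines C B].

End Charts.

Definition paracompact (T : topologicalType) : Prop :=
  forall U : set (set T), U `<=` open -> \bigcup_(u in U) u = setT ->
    exists V : set (set T),
      [/\ V `<=` open,
          \bigcup_(v in V) v = setT,
          (forall v, V v -> exists2 u, U u & v `<=` u) &
          forall x : T, exists2 W, nbhs x W &
            finite_set [set v | V v /\ v `&` W !=set0]].

(* An equivalence class of atlases is represented by its maximal atlas, i.e. the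
   union of all atlases of the class. *)
Record orbifold (R : realType) := Orbifold {
  ospace :> topologicalType;
  orbdim : nat;
  oatlas : ochart_family R ospace orbdim;
  orbdim_gt0 : (0 < orbdim)%N;
  ospace_hausdorff : hausdorff_space ospace;
  ospace_paracompact : paracompact ospace;
  ospace_components : countable (range (connected_component [set: ospace]));
  oatlas_analytic : analytic_atlas oatlas;
  oatlas_maximal : forall B, analytic_atlas B -> equivalent_atlases B oatlas ->
    forall c, B c -> oatlas c }.

Arguments oatlas {R} X : rename.

Section SubanalyticOrbifolds.
Context {R : realType}.

Definition osubanalytic (X : orbifold R) (A : set X) : Prop :=
  forall x : X, exists c, [/\ oatlas X c, oimage c x &
    @subanalytic R (open_manifold (odom c))
      (@oproj _ _ _ c @^-1` (A `&` oimage c))].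

Definition osubanalytic_map (X Y : orbifold R) (f : X -> Y) : Prop :=
  forall x : X, exists c d,
    [/\ oatlas X c, oatlas Y d, oimage c x, oimage d (f x) &
        f @` oimage c `<=` oimage d] /\
    exists (theta : ogroup c -> ogroup d) (g : odom c -> odom d),
      [/\ {morph theta : a b / (a * b)%g},
          @subanalytic_map R (open_manifold (odom c)) (open_manifold (odom d)) g,
          (forall a z, g (oact a z) = oact (theta a) (g z)) &
          forall z, oproj (g z) = f (oproj z)].

Definition proper_map (S T : topologicalType) (f : S -> T) : Prop :=
  forall K : set T, compact K -> compact (f @^-1` K).

End SubanalyticOrbifolds.

(* Main.v *)
Require Import Defs.
From mathcomp Require Import all_boot all_order all_algebra all_fingroup finmap.
From mathcomp.analysis.showcase Require Import summability.
From mathcomp Require Import all_classical all_reals all_analysis.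
From mathcomp Require Import lra.

Set Implicit Arguments.
Unset Strict Implicit.
Unset Printing Implicit Defensive.

Import Order.TTheory GRing.Theory Num.Theory.
Import numFieldNormedType.Exports.

Local Open Scope classical_set_scope.
Local Open Scope ring_scope.

(** The class of subanalytic sets is, by its very definition, the class of local
    projections of relatively compact semianalytic sets, so that statements on
    images and inverse images reduce to the stability of such projections under
    a few operations; none of them needs the theorem of the complement or the
    resolution of singularities.

    Call [semianalytic_projection] the projection to [M] of a relatively compact
    semianalytic subset of some [M * N]. These sets are stable under finite
    unions ([semianalytic_projectionU]) and under composition of relations
    ([semianalytic_projection_comp]): if [A] in [M] is the projection of [C] and
    a relation [S] in [N * M] is the projection of [B], then the set of the
    points related by [S] to a point of [A] is the projection of the fiber
    product of [B] and [C] over [M]. A set is subanalytic exactly when, near each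
    point, it coincides with a semianalytic projection that it contains
    ([subanalyticP]); working with such germs avoids cutting the projections off
    by neighborhoods.

    The passage from one orbifold chart to another is also a composition of
    relations. If [c] and [d] are charts of the same orbifold, the set of the
    pairs [(z, v)] with [oproj z = oproj v] is subanalytic
    ([subanalytic_chart_fiber_product]): with a chart [k] that embeds in [c] by
    [m] and in [d] by [l], it is locally the finite union over the elements [b]
    of the group of [d] of the sets of the pairs [(a . m w, b . l w)], where [w]
    ranges over a cube. Each of these is the projection of the set of the
    [((z, v), w)] with [a^-1 . z = m w] and [b^-1 . v = l w]. The equations are
    written so that an analytic function is only ever composed with a projection
    onto some of the coordinates; composition of power series never occurs.

    It follows that a subanalytic subset of an orbifold is subanalytic in every
    chart ([osubanalytic_chart]), and the inverse image under [f] is read in the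
    charts as the transform by the graph of the lift of [f]. For the image, fix a
    point [z] of a chart of [Y] and a point [x] of the fiber of [f] over the
    image of [z]: the points of [f @` A] that come from points of [A] close to
    [x] are obtained from [A] by two successive relations, the graph of the lift
    of [f] and the change of charts ([osubanalytic_image_local]). The fiber is
    compact, so finitely many [x] are enough, and as [f] is closed these account
    for all points of [f @` A] close to the image of [z] ([proper_fiber_nbhs]). *)

(** * Unconditional sums and analytic functions *)

Local Existing Instance totally_filter.

Section UnconditionalSums.
Context {R : realType}.

Lemma partial_sumE (I : choiceType) (f : I -> R) (A : {fset I}) :
  partial_sum f A = \sum_(i <- A) f i.
Proof. by rewrite /partial_sum big_seq_fsetE. Qed.

Lemma partial_sum_single (I : choiceType) (f : I -> R) (i0 : I) :
  (forall i, i != i0 -> f i = 0) -> partial_sum f @ totally --> f i0.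
Proof.
move=> f0; apply: cvg_near_cst; exists [fset i0]%fset => // A /= A0.
have i0A : i0 \in A by move/fsubsetP: A0; apply; rewrite inE.
rewrite partial_sumE (bigD1_seq i0) ?fset_uniq //= big1 ?addr0 //.
Qed.

(** The sum of a family [g] that extends [f] by zero along an injection [e],
    with retraction [r], is the sum of [f]. *)
Lemma partial_sum_inj (I J : choiceType) (e : I -> J) (r : J -> I)
    (f : I -> R) (g : J -> R) (l : R) :
  cancel e r -> (forall i, g (e i) = f i) ->
  (forall j, e (r j) != j -> g j = 0) ->
  partial_sum f @ totally --> l -> partial_sum g @ totally --> l.
Proof.
move=> er ge g0 fl.
pose h (A : {fset J}) := [fset r j | j in [fset j in A | e (r j) == j]]%fset.
have -> : partial_sum g = partial_sum f \o h.
  apply/funext => A /=; rewrite !partial_sumE.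
  rewrite (bigID (fun j => e (r j) == j)) /= [X in _ + X]big1_seq ?addr0.
    2: by move=> j /andP[/g0].
  rewrite big_imfset /=; last first.
    move=> i j; rewrite !inE => /andP[_ /eqP <-] /andP[_ /eqP <-].
    by rewrite !er => ->.
  rewrite big_fset; apply: eq_bigr => j /eqP {1}<-.
  by rewrite ge.
apply: (@cvg_comp _ _ _ h (partial_sum f) totally totally) fl.
move=> P [A _ AP]; exists [fset e i | i in A]%fset => // B /= AB.
apply: AP => /=; apply/fsubsetP => i iA; apply/imfsetP; exists (e i).
  by rewrite !inE er eqxx andbT; apply: (fsubsetP AB); rewrite in_imfset.
by rewrite er.
Qed.

End UnconditionalSums.

Section AnalyticAt.
Context {R : realType}.

Lemma analytic_at_cst n (x : 'rV[R]_n) (k : R) : analytic_at x (fun=> k).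
Proof.
exists (fun a => if a == [ffun=> 0%N] then k else 0).
apply: filterE => y /=.
set F := (X in partial_sum X).
have -> : k = F [ffun=> 0%N].
  by rewrite /F eqxx big1 ?mulr1 // => i _; rewrite ffunE expr0.
by apply: partial_sum_single => a /negbTE; rewrite /F => ->; rewrite mul0r.
Qed.

Lemma analytic_atD n (x : 'rV[R]_n) (f g : 'rV[R]_n -> R) :
  analytic_at x f -> analytic_at x g -> analytic_at x (fun y => f y + g y).
Proof.
move=> [c cf] [d dg]; exists (fun a => c a + d a).
near=> y; rewrite /=.
have -> : partial_sum (fun a => (c a + d a) * \prod_i (y 0 i - x 0 i) ^+ a i) =
    partial_sum (fun a => c a * \prod_i (y 0 i - x 0 i) ^+ a i) +
    partial_sum (fun a => d a * \prod_i (y 0 i - x 0 i) ^+ a i).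
  apply/funext => A /=; rewrite fctE !partial_sumE -big_split /=.
  by apply: eq_bigr => a _; rewrite mulrDl.
by apply: cvgD; near: y.
Unshelve. all: end_near. Qed.

Lemma analytic_atN n (x : 'rV[R]_n) (f : 'rV[R]_n -> R) :
  analytic_at x f -> analytic_at x (fun y => - f y).
Proof.
move=> [c cf]; exists (fun a => - c a).
near=> y; rewrite /=.
have -> : partial_sum (fun a => - c a * \prod_i (y 0 i - x 0 i) ^+ a i) =
    - partial_sum (fun a => c a * \prod_i (y 0 i - x 0 i) ^+ a i).
  apply/funext => A /=; rewrite fctE !partial_sumE -sumrN /=.
  by apply: eq_bigr => a _; rewrite mulNr.
by apply: cvgN; near: y.
Unshelve. all: end_near. Qed.

Lemma analytic_atB n (x : 'rV[R]_n) (f g : 'rV[R]_n -> R) :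
  analytic_at x f -> analytic_at x g -> analytic_at x (fun y => f y - g y).
Proof. by move=> hf hg; apply: analytic_atD => //; exact: analytic_atN. Qed.

Lemma analytic_at_coord n (x : 'rV[R]_n) (i : 'I_n) :
  analytic_at x (fun y => y 0 i).
Proof.
have -> : (fun y : 'rV[R]_n => y 0 i) = (fun y => (y 0 i - x 0 i) + x 0 i).
  by apply/funext => y; rewrite subrK.
apply: analytic_atD; last exact: analytic_at_cst.
pose e : {ffun 'I_n -> nat} := [ffun j => (j == i) : nat].
exists (fun a => if a == e then 1 else 0).
apply: filterE => y /=.
set F := (X in partial_sum X).
have -> : y 0 i - x 0 i = F e.
  rewrite /F eqxx mul1r (bigD1 i) //= big1 ?mulr1 ?ffunE ?eqxx ?expr1 //.
  by move=> j /negbTE ji; rewrite ffunE ji expr0.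
by apply: partial_sum_single => a /negbTE; rewrite /F => ->; rewrite mul0r.
Qed.

(** The point whose coordinates are those of [y] with indices
    [s 0], [s 1], etc. *)
Definition select p q (s : 'I_p -> 'I_q) (y : 'rV[R]_q) : 'rV[R]_p :=
  \row_i y 0 (s i).

Lemma select_continuous p q (s : 'I_p -> 'I_q) : continuous (select s).
Proof.
move=> y; apply/(@cvg_ballP _ _ _ (nbhs y) _ (select s)) => e e0.
apply: filterS (nbhsx_ballx y e e0) => z [_ yz].
by split=> // i j; rewrite !mxE.
Qed.

(** A power series in the selected coordinates is a power series in all the
    coordinates: the coefficient of a multi-index [b] is [0] unless [b] is the
    extension by zero [e a] of a multi-index [a] along [s]. *)
Lemma analytic_at_select p q (s : 'I_p -> 'I_q) (y : 'rV[R]_q)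
    (f : 'rV[R]_p -> R) :
  injective s -> analytic_at (select s y) f -> analytic_at y (f \o select s).
Proof.
move=> s_inj [c cf].
pose r (b : {ffun 'I_q -> nat}) : {ffun 'I_p -> nat} := [ffun i => b (s i)].
pose e (a : {ffun 'I_p -> nat}) : {ffun 'I_q -> nat} :=
  [ffun j => if [pick i | s i == j] is Some i then a i else 0%N].
have er : cancel e r.
  move=> a; apply/ffunP => i; rewrite !ffunE.
  case: pickP => [k /eqP/s_inj -> //|].
  by move/(_ i); rewrite eqxx.
exists (fun b => if e (r b) == b then c (r b) else 0).
have := @select_continuous _ _ s y _ cf; apply: (@filterS _ (nbhs y)) => z /=.
apply: (partial_sum_inj er) => [a|b /negbTE ->]; last by rewrite mul0r.
rewrite er eqxx; congr (_ * _).
rewrite (bigID [pred j | j \in (s @: [set: 'I_p])%SET]) /=.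
rewrite [X in _ * X]big1 ?mulr1.
  rewrite big_imset /=; last by move=> i k _ _; exact: s_inj.
  rewrite big_mkcond /=; apply: eq_bigr => i _.
  rewrite finset.in_setT /select !mxE ffunE.
  case: pickP => [k /eqP/s_inj -> //|].
  by move/(_ i); rewrite eqxx.
move=> j sj; rewrite ffunE.
case: pickP => [k /eqP skj|_]; last by rewrite expr0.
by case/imsetP: sj; exists k; rewrite ?finset.in_setT.
Qed.

End AnalyticAt.

(** * Semianalytic sets *)

Section Semianalytic.
Context {R : realType}.
Implicit Types M N P Q : manifold_data R.

Lemma analytic_function_sub M (U V : set M) f :
  V `<=` U -> analytic_function U f -> analytic_function V f.
Proof.
move=> VU fU c Mc; have [g gan gf] := fU c Mc.
by exists g => x cx /VU; [exact: gan | exact: gf].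
Qed.

Lemma analytic_function_cst M (U : set M) (k : R) :
  analytic_function U (fun=> k).
Proof. by move=> c _; exists (fun=> k) => // x _ _; exact: analytic_at_cst. Qed.

Lemma analytic_functionB M (U : set M) f f' :
  analytic_function U f -> analytic_function U f' ->
  analytic_function U (fun x => f x - f' x).
Proof.
move=> fU f'U c Mc; have [g gan gf] := fU c Mc; have [g' g'an g'f] := f'U c Mc.
exists (fun y => g y - g' y) => x cx Ux; last by rewrite gf ?g'f.
by apply: analytic_atB; [exact: gan|exact: g'an].
Qed.

Lemma analytic_algebra_sub M (U V A : set M) :
  V `<=` U -> analytic_algebra U A -> analytic_algebra V (A `&` V).
Proof.
move=> VU; elim=> {A} [f fU|A B _ iA _ iB|A B _ iA _ iB|A _ iA].
- rewrite (_ : _ `&` _ = [set x | V x /\ 0 < f x]); last first.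
    apply/seteqP; split=> x /= => [[[_ ?] ?]|[Vx ?]]; do ?split=> //.
    exact: VU.
  exact/algebra_pos/analytic_function_sub/fU.
- by rewrite setIIl; exact: algebra_setI.
- by rewrite setIUl; exact: algebra_setU.
- rewrite (_ : _ `&` _ = V `\` (A `&` V)); first exact: algebra_setD.
  apply/seteqP; split=> x /= => [[[_ nA] Vx]|[Vx nA]].
    by split=> // -[].
  by do 2?split=> //; [exact: VU|move=> Ax; exact: nA].
Qed.

Lemma analytic_algebra0 M (U : set M) : analytic_algebra U set0.
Proof.
rewrite (_ : set0 = [set x | U x /\ 0 < (fun=> 0 : R) x]).
  exact/algebra_pos/analytic_function_cst.
by apply/seteqP; split=> x //= []; rewrite ltxx.
Qed.

Lemma analytic_algebraT M (U : set M) : analytic_algebra U U.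
Proof. by rewrite -[X in _ _ X]setD0; exact/algebra_setD/analytic_algebra0. Qed.

Lemma analytic_algebra_le0 M (U : set M) f : analytic_function U f ->
  analytic_algebra U [set x | U x /\ f x <= 0].
Proof.
move=> fU; rewrite (_ : [set _ | _] = U `\` [set x | U x /\ 0 < f x]).
  exact/algebra_setD/algebra_pos.
apply/seteqP; split=> x /= [Ux].
  by move=> fx; split=> // -[_]; rewrite ltNge fx.
by move=> fx; split=> //; rewrite leNgt; apply/negP => ?; exact: fx.
Qed.

Lemma analytic_algebra_forall_le0 M (U : set M) n (f : 'I_n -> M -> R) :
  (forall i, analytic_function U (f i)) ->
  analytic_algebra U [set x | U x /\ forall i, f i x <= 0].
Proof.
move=> fU.
suff H (s : seq 'I_n) :
    analytic_algebra U [set x | U x /\ forall i, i \in s -> f i x <= 0].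
  rewrite (_ : [set _ | _] =
    [set x | U x /\ forall i, i \in enum 'I_n -> f i x <= 0]) //.
  apply/seteqP; split=> x /= [Ux fx]; split=> //.
  by move=> i; apply: fx; rewrite mem_enum.
elim: s => [|i s IHs].
  rewrite (_ : [set _ | _] = U); first exact: analytic_algebraT.
  by apply/seteqP; split=> x /=; [case | move=> Ux; split].
rewrite (_ : [set _ | _] = [set x | U x /\ f i x <= 0] `&`
    [set x | U x /\ forall i, i \in s -> f i x <= 0]).
  by apply: algebra_setI => //; exact: analytic_algebra_le0.
apply/seteqP; split=> x /= => [[Ux fx]|[[_ fix_le0] [Ux fx]]].
  split; first by split=> //; apply: fx; rewrite mem_head.
  by split=> // j js; apply: fx; rewrite inE js orbT.
by split=> // j; rewrite inE => /orP[/eqP -> //|]; exact: fx.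
Qed.

(** A set that is defined on the whole manifold by finitely many weak analytic
    inequalities. *)
Lemma semianalytic_forall_le0 M n (f : 'I_n -> M -> R) :
  (forall i, analytic_function setT (f i)) ->
  semianalytic [set x | forall i, f i x <= 0].
Proof.
move=> fT x; exists setT; split=> //; first exact: openT.
rewrite setIC; exact: analytic_algebra_forall_le0.
Qed.

Lemma semianalytic0 M : semianalytic (@set0 M).
Proof.
move=> x; exists setT; split=> //; first exact: openT.
by rewrite set0I; exact: analytic_algebra0.
Qed.

Lemma semianalytic_common M (A B : set M) x :
  semianalytic A -> semianalytic B ->
  exists U, [/\ open U, U x, analytic_algebra U (A `&` U) &
                analytic_algebra U (B `&` U)].
Proof.
move=> hA hB; have [U [oU Ux AU]] := hA x; have [V [oV Vx BV]] := hB x.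
have restr C W : U `&` V `<=` W -> analytic_algebra W (C `&` W) ->
    analytic_algebra (U `&` V) (C `&` (U `&` V)).
  move=> UVW /(analytic_algebra_sub UVW); rewrite -setIA.
  by rewrite (setIidr UVW).
exists (U `&` V); split=> //; first exact: openI.
  by apply: restr AU => ? [].
by apply: restr BV => ? [].
Qed.

Lemma semianalyticI M (A B : set M) :
  semianalytic A -> semianalytic B -> semianalytic (A `&` B).
Proof.
move=> hA hB x; have [U [oU Ux AU BU]] := semianalytic_common x hA hB.
by exists U; split=> //; rewrite setIIl; exact: algebra_setI.
Qed.

Lemma semianalyticU M (A B : set M) :
  semianalytic A -> semianalytic B -> semianalytic (A `|` B).
Proof.
move=> hA hB x; have [U [oU Ux AU BU]] := semianalytic_common x hA hB.
by exists U; split=> //; rewrite setIUl; exact: algebra_setU.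
Qed.

End Semianalytic.

(** * Topological preliminaries *)

Lemma continuous_at_pair (S T U : topologicalType) (f : S -> T) (g : S -> U) x :
  {for x, continuous f} -> {for x, continuous g} ->
  {for x, continuous (fun x => (f x, g x))}.
Proof. by move=> cf cg; apply: cvg_pair; [exact: cf|exact: cg]. Qed.

Lemma continuous_pair (S T U : topologicalType) (f : S -> T) (g : S -> U) :
  continuous f -> continuous g -> continuous (fun x => (f x, g x)).
Proof.
by move=> cf cg x; apply: continuous_at_pair; [exact: cf|exact: cg].
Qed.

Lemma continuous_fst_comp (S T U : topologicalType) (f : S -> T * U) :
  continuous f -> continuous (fun x => (f x).1).
Proof. by move=> cf x; apply: continuous_comp; [exact: cf|exact: cvg_fst]. Qed.

Lemma continuous_snd_comp (S T U : topologicalType) (f : S -> T * U) :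
  continuous f -> continuous (fun x => (f x).2).
Proof. by move=> cf x; apply: continuous_comp; [exact: cf|exact: cvg_snd]. Qed.

Section ProductSpaces.
Context {S T : topologicalType}.

Lemma hausdorff_prod :
  hausdorff_space S -> hausdorff_space T -> hausdorff_space (S * T)%type.
Proof.
move=> hS hT [p1 p2] [q1 q2] pq; congr pair.
  apply: hS => A B pA qB.
  have [] := pq (A `*` setT) (B `*` setT).
  - by exists (A, setT) => //; split=> //; exact: filterT.
  - by exists (B, setT) => //; split=> //; exact: filterT.
  by move=> [x y] [[/= ? _] [? _]]; exists x.
apply: hT => A B pA qB.
have [] := pq (setT `*` A) (setT `*` B).
- by exists (setT, A) => //; split=> //; exact: filterT.
- by exists (setT, B) => //; split=> //; exact: filterT.
by move=> [x y] [[/= _ ?] [_ ?]]; exists y.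
Qed.

Lemma open_setX (A : set S) (B : set T) : open A -> open B -> open (A `*` B).
Proof.
rewrite !openE => oA oB [x y] [/= Ax By].
by exists (A, B) => //; split; [exact: oA|exact: oB].
Qed.

Lemma second_countable_prod :
  @second_countable S -> @second_countable T -> @second_countable (S * T)%type.
Proof.
move=> [A cA [oA bA]] [B cB [oB bB]].
exists ((fun p : set S * set T => p.1 `*` p.2) @` (A `*` B)).
  exact: (card_le_trans (card_image_le _ _) (countableX cA cB)).
split=> [_ [[U V] [/= AU BV] <-]|[x y] W [[W1 W2] /= [xW1 yW2] W12]].
  by apply: open_setX; [exact: oA|exact: oB].
have [U [AU Ux] UW] := bA x _ xW1; have [V [BV Vy] VW] := bB y _ yW2.
exists (U `*` V); first by split=> //; exists (U, V).
by move=> [u v] [/= /UW ? /VW ?]; exact: W12.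
Qed.
End ProductSpaces.

Lemma compact_closure_sub (T : topologicalType) (B K : set T) :
  hausdorff_space T -> compact K -> B `<=` K -> compact (closure B).
Proof.
move=> hT cK BK; apply: (subclosed_compact (@closed_closure _ B) cK).
by rewrite (closure_id K).1; [exact: closure_subset|exact: compact_closed].
Qed.

Lemma set_type_second_countable (T : topologicalType) (V : set T) :
  @second_countable T -> @second_countable V.
Proof.
move=> [B cB [oB bB]]; exists ((fun U => set_val @^-1` U : set V) @` B).
  exact: (card_le_trans (card_image_le _ _) cB).
split=> [_ [U BU <-]|x W].
  by exists U => //; exact: oB.
move=> [_ [[U oU <-] Ux] UW].
have [C [BC Cx] CU] := bB (set_val x) U (open_nbhs_nbhs (conj oU Ux)).
exists (set_val @^-1` C); first by split=> //; exists C.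
by move=> y Cy; apply/UW/CU.
Qed.

Lemma set_type_hausdorff (T : topologicalType) (V : set T) :
  hausdorff_space T -> hausdorff_space V.
Proof.
move=> hT p q pq; apply/val_inj/hT => A B pA qB.
have [x [Ax Bx]] := pq _ _ (@initial_continuous V T set_val p _ pA)
  (@initial_continuous V T set_val q _ qB).
by exists (set_val x).
Qed.

Lemma embedding_nbhs (S T : topologicalType) (l : S -> T) (x : S) (U : set S) :
  topological_embedding l -> open (range l) -> nbhs x U -> nbhs (l x) (l @` U).
Proof.
move=> [_ _ lO] ol; rewrite [nbhs x]nbhsE => -[V [oV Vx] VU].
have [W oW VW] := lO _ oV.
apply: (@filterS _ (nbhs (l x)) _ (W `&` range l)).
  by move=> q [Wq [y _ yE]]; exists y => //; apply: VU; rewrite VW /= yE.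
apply: open_nbhs_nbhs; split; first exact: openI.
by split; [move: Vx; rewrite VW|exists x].
Qed.

(** * Coordinate maps between manifolds *)

Section CoordinateMaps.
Context {R : realType}.
Implicit Types M N P Q L : manifold_data R.

(** A continuous map that is, in suitable charts, the projection onto some of
    the coordinates: the injection [s] gives the indices of these. Only charts of
    the given atlases are used, and each chart [e] of [P] must be sent into a
    single chart [d] of [Q]. *)
Definition coordinate_map P Q (p : P -> Q) : Prop :=
  continuous p /\
  forall e, matlas P e -> exists d (s : 'I_(mdim Q) -> 'I_(mdim P)),
    [/\ matlas Q d, injective s & forall x, mdom e x ->
        mdom d (p x) /\ mmap d (p x) = select s (mmap e x)].

Lemma analytic_function_comp P Q (p : P -> Q) (U : set Q) (f : Q -> R) :
  coordinate_map p -> analytic_function U f ->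
  analytic_function (p @^-1` U) (f \o p).
Proof.
move=> [_ cp] fU e Pe; have [d [s [Qd s_inj ds]]] := cp e Pe.
have [g gan gf] := fU d Qd; exists (g \o select s) => x ex Upx.
  have [dx dsx] := ds x ex.
  by apply: analytic_at_select => //; rewrite -dsx; exact: gan.
by have [dx dsx] := ds x ex; rewrite /= -dsx gf.
Qed.

Lemma analytic_algebra_preimage P Q (p : P -> Q) (U A : set Q) :
  coordinate_map p -> analytic_algebra U A ->
  analytic_algebra (p @^-1` U) (p @^-1` A).
Proof.
move=> cp; elim=> {A} [f fU|A B _ iA _ iB|A B _ iA _ iB|A _ iA].
- exact/(@algebra_pos _ _ _ (f \o p))/analytic_function_comp.
- exact: algebra_setI.
- exact: algebra_setU.
- exact: algebra_setD.
Qed.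

Lemma semianalytic_preimage P Q (p : P -> Q) (A : set Q) :
  coordinate_map p -> semianalytic A -> semianalytic (p @^-1` A).
Proof.
move=> cp hA x; have [U [oU Upx AU]] := hA (p x).
exists (p @^-1` U); split=> //; last exact: (analytic_algebra_preimage cp AU).
by apply: open_comp oU => ? _; exact: cp.1.
Qed.

Lemma coordinate_map_id P : coordinate_map (@id P).
Proof.
split=> [x|e Pe]; first exact: cvg_id.
by exists e, id; split=> // x ex; split=> //; apply/rowP => i; rewrite mxE.
Qed.

Lemma coordinate_map_comp P Q L (p : P -> Q) (q : Q -> L) :
  coordinate_map p -> coordinate_map q -> coordinate_map (q \o p).
Proof.
move=> [cp hp] [cq hq]; split=> [x|e Pe].
  by apply: continuous_comp; [exact: cp|exact: cq].
have [d [s [Qd s_inj ds]]] := hp e Pe; have [k [t [Lk t_inj kt]]] := hq d Qd.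
exists k, (s \o t); split=> //; first exact: inj_comp.
move=> x /ds[dx dE]; have [kx kE] := kt _ dx; split=> //=.
by rewrite kE dE; apply/rowP => i; rewrite !mxE.
Qed.

Lemma coordinate_map_fst M N :
  coordinate_map (fst : prod_manifold M N -> M).
Proof.
split=> [x|e [c [d [Mc Nd ->]]]]; first exact: cvg_fst.
exists c, (@lshift _ _); split=> //; first exact: lshift_inj.
move=> x [/= cx dx]; split=> //.
by apply/rowP => i; rewrite mxE row_mxEl.
Qed.

Lemma coordinate_map_snd M N :
  coordinate_map (snd : prod_manifold M N -> N).
Proof.
split=> [x|e [c [d [Mc Nd ->]]]]; first exact: cvg_snd.
exists d, (@rshift _ _); split=> //; first exact: rshift_inj.
move=> x [/= cx dx]; split=> //.
by apply/rowP => i; rewrite mxE row_mxEr.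
Qed.

(** The selection [s] on the first block of coordinates and [t] on the second
    one. *)
Definition sum_select p q p' q' (s : 'I_p -> 'I_p') (t : 'I_q -> 'I_q')
    (i : 'I_(p + q)) : 'I_(p' + q') :=
  match fintype.split i with
  | inl j => lshift q' (s j)
  | inr j => rshift p' (t j)
  end.

Lemma sum_select_inj p q p' q' (s : 'I_p -> 'I_p') (t : 'I_q -> 'I_q') :
  injective s -> injective t -> injective (sum_select s t).
Proof.
move=> s_inj t_inj i j; rewrite /sum_select.
case: (splitP i) => a ia; case: (splitP j) => b jb => /eqP.
- by rewrite eq_lshift => /eqP/s_inj ab; apply/val_inj; rewrite /= ia jb ab.
- by rewrite eq_lrshift.
- by rewrite eq_rlshift.
- by rewrite eq_rshift => /eqP/t_inj ab; apply/val_inj; rewrite /= ia jb ab.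
Qed.

Lemma select_row_mx p q p' q' (s : 'I_p -> 'I_p') (t : 'I_q -> 'I_q')
    (y : 'rV[R]_p') (z : 'rV[R]_q') :
  select (sum_select s t) (row_mx y z) = row_mx (select s y) (select t z).
Proof.
apply/rowP => i; rewrite mxE /sum_select [RHS]mxE.
by case: (fintype.split i) => j; rewrite ?row_mxEl ?row_mxEr mxE.
Qed.

Lemma coordinate_map_prod M N P Q (p : M -> P) (q : N -> Q) :
  coordinate_map p -> coordinate_map q ->
  @coordinate_map (prod_manifold M N) (prod_manifold P Q)
    (fun x => (p x.1, q x.2)).
Proof.
move=> [cp hp] [cq hq]; split=> [x|e [c [d [Mc Nd ->]]]].
  apply: cvg_pair.
    by apply: cvg_comp; [exact: cvg_fst|exact: cp].
  by apply: cvg_comp; [exact: cvg_snd|exact: cq].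
have [c' [s [Pc' s_inj cs]]] := hp c Mc.
have [d' [t [Qd' t_inj dt]]] := hq d Nd.
exists (MChart (mdom c' `*` mdom d')
  (fun x => row_mx (mmap c' x.1) (mmap d' x.2))).
exists (sum_select s t); split; [by exists c', d'|exact: sum_select_inj|].
move=> x [/= /cs[? cE] /dt[? dE]]; split=> //.
by rewrite select_row_mx cE dE.
Qed.

Lemma coordinate_map_swap M N :
  @coordinate_map (prod_manifold M N) (prod_manifold N M)
    (fun x => (x.2, x.1)).
Proof.
split=> [x|e [c [d [Mc Nd ->]]]].
  by apply: cvg_pair; [exact: cvg_snd|exact: cvg_fst].
exists (MChart (mdom d `*` mdom c)
  (fun x => row_mx (mmap d x.1) (mmap c x.2))).
exists (fun i => match fintype.split i with
  | inl j => rshift _ j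
  | inr j => lshift _ j
  end).
split; first by exists d, c.
  move=> i j; case: (splitP i) => a ia; case: (splitP j) => b jb => /eqP.
  - by rewrite eq_rshift => /eqP ab; apply/val_inj; rewrite /= ia jb ab.
  - by rewrite eq_rlshift.
  - by rewrite eq_lrshift.
  - by rewrite eq_lshift => /eqP ab; apply/val_inj; rewrite /= ia jb ab.
move=> x [/= cx dx]; split=> //; apply/rowP => i; rewrite mxE [RHS]mxE.
by case: (fintype.split i) => j; rewrite ?row_mxEl ?row_mxEr.
Qed.

Lemma coordinate_map_assoc M N L :
  @coordinate_map (prod_manifold M (prod_manifold N L))
    (prod_manifold (prod_manifold M N) L)
    (fun x => ((x.1, x.2.1), x.2.2)).
Proof.
split=> [|_ [c [_ [Mc [d [e [Nd Le ->]]] ->]]]].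
  have csnd (S T U : topologicalType) (h : T -> U) : continuous h ->
      continuous (fun x : S * T => h x.2).
    by move=> ch x; apply: cvg_comp; [exact: cvg_snd|exact: ch].
  apply: (@continuous_pair (M * (N * L))%type (M * N)%type L).
    apply: (@continuous_pair (M * (N * L))%type M N).
      by move=> ?; exact: cvg_fst.
    by apply: csnd => ?; exact: cvg_fst.
  by apply: csnd => ?; exact: cvg_snd.
exists (MChart ((mdom c `*` mdom d) `*` mdom e)
  (fun x => row_mx (row_mx (mmap c x.1.1) (mmap d x.1.2)) (mmap e x.2))).
exists (cast_ord (esym (addnA _ _ _))); split.
- exists (MChart (mdom c `*` mdom d)
    (fun x => row_mx (mmap c x.1) (mmap d x.2))), e.
  by split=> //; exists c, d.
- exact: cast_ord_inj.
move=> x [/= cx [dx ex]]; split=> //; apply/rowP => i.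
by rewrite [RHS]mxE row_mxA castmxE; congr fun_of_matrix; exact: val_inj.
Qed.

End CoordinateMaps.

(** * Products and open subsets as manifolds *)

Section RowBlocks.
Context {R : realType}.

Lemma select_lshiftE m n (y : 'rV[R]_(m + n)) :
  select (@lshift m n) y = lsubmx y.
Proof. by apply/rowP => i; rewrite !mxE. Qed.

Lemma select_rshiftE m n (y : 'rV[R]_(m + n)) :
  select (@rshift m n) y = rsubmx y.
Proof. by apply/rowP => i; rewrite !mxE. Qed.

Lemma row_mx_continuous m n :
  continuous (fun p : 'rV[R]_m * 'rV[R]_n => row_mx p.1 p.2).
Proof.
move=> p; apply/(@cvg_ballP _ _ _ (nbhs p)) => e e0.
apply: filterS (nbhsx_ballx p e e0) => q [[_ pq1] [_ pq2]].
by split=> // i j; rewrite !mxE; case: (fintype.split j).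
Qed.

Lemma row_mx_open m n (A : set 'rV[R]_m) (B : set 'rV[R]_n) :
  open A -> open B -> open [set row_mx p.1 p.2 | p in A `*` B].
Proof.
move=> oA oB.
rewrite (_ : [set _ | _ in _] = (lsubmx @^-1` A) `&` (rsubmx @^-1` B)).
  apply: openI; apply: open_comp => // y _; first exact: continuous_lsubmx.
  exact: continuous_rsubmx.
apply/seteqP; split=> [_ [[a b] [/= Aa Bb] <-]|y [/= Ay By]].
  by rewrite /= row_mxKl row_mxKr.
by exists (lsubmx y, rsubmx y) => //=; rewrite hsubmxK.
Qed.
End RowBlocks.

Section ManifoldInstances.
Context {R : realType}.
Implicit Types M N : manifold_data R.

Lemma is_manifold_prod M N :
  is_manifold M -> is_manifold N -> is_manifold (prod_manifold M N).
Proof.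
move=> [hM sM cM covM tM] [hN sN cN covN tN]; split.
- exact: hausdorff_prod.
- exact: second_countable_prod.
- move=> _ [c [d [Mc Nd ->]]].
  have [oc cc ic occ] := cM c Mc; have [od cd id' ocd] := cN d Nd.
  split=> /=.
  + exact: open_setX.
  + rewrite continuous_open_subspace; last exact: open_setX.
    rewrite continuous_open_subspace // in cc.
    rewrite continuous_open_subspace // in cd.
    move=> [x y]; rewrite in_setE => -[/= cx dy].
    apply: (@continuous_comp _ _ _ (fun p : M * N => (mmap c p.1, mmap d p.2))
      (fun p => row_mx p.1 p.2)); last exact: row_mx_continuous.
    apply: continuous_at_pair.
      by apply: continuous_comp; [exact: cvg_fst|apply: cc; rewrite inE].
    by apply: continuous_comp; [exact: cvg_snd|apply: cd; rewrite inE].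
  + move=> [x y] [x' y'] [/= cx dy] [/= cx' dy'] /eq_row_mx[cE dE].
    by rewrite (ic x x') // (id' y y').
  + move=> O oO OD; rewrite openE => _ [[x y] Oxy <-] /=.
    have [/= cx dy] := OD _ Oxy.
    have [[U V] [/= Ux Vy] UVO] : nbhs (x, y) O by exact: open_nbhs_nbhs.
    have oU : open (U^° `&` mdom c).
      by apply: openI => //; exact: open_interior.
    have oV : open (V^° `&` mdom d).
      by apply: openI => //; exact: open_interior.
    have oUV := row_mx_open (occ _ oU (@subIsetr _ _ _))
                            (ocd _ oV (@subIsetr _ _ _)).
    apply: (@filterS _ (nbhs (row_mx (mmap c x) (mmap d y)))); last first.
      apply: open_nbhs_nbhs; split; first exact: oUV.
      exists (mmap c x, mmap d y) => //.
      by split; [exists x|exists y].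
    move=> _ [_ [[u [Uu _] /= <-] [v [Vv _] /= <-]] <-].
    by exists (u, v) => //; apply: UVO; split; exact: interior_subset.
- move=> [x y]; have [c Mc cx] := covM x; have [d Nd dy] := covN y.
  exists (MChart (mdom c `*` mdom d)
    (fun p => row_mx (mmap c p.1) (mmap d p.2))) => //.
  by exists c, d.
move=> _ _ [c [d [Mc Nd ->]]] [c' [d' [Mc' Nd' ->]]].
have [t tan tE] := tM c c' Mc Mc'; have [u uan uE] := tN d d' Nd Nd'.
exists (fun y => row_mx (t (lsubmx y)) (u (rsubmx y))) => /=; last first.
  by move=> [x y] [/= ? ?] [/= ? ?]; rewrite row_mxKl row_mxKr tE // uE.
move=> _ [[x y] [/= [/= cx dy] [/= c'x d'y]] <-] i.
case: (split_ordP i) => j ->.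
- rewrite (_ : (fun _ => _) = (fun y => t y 0 j) \o select (@lshift _ _)).
    2: by apply/funext => z; rewrite row_mxEl /= select_lshiftE.
  apply: analytic_at_select; first exact: lshift_inj.
  by rewrite select_lshiftE row_mxKl; apply: tan; exists x.
- rewrite (_ : (fun _ => _) = (fun y => u y 0 j) \o select (@rshift _ _)).
    2: by apply/funext => z; rewrite row_mxEr /= select_rshiftE.
  apply: analytic_at_select; first exact: rshift_inj.
  by rewrite select_rshiftE row_mxKr; apply: uan; exists y.
Qed.

End ManifoldInstances.

Section OpenManifold.
Context {R : realType}.

(** The open boxes with rational vertices, a countable basis of the topology. *)
Definition rational_box n (pq : 'rV[rat]_n * 'rV[rat]_n) : set 'rV[R]_n :=
  [set y | forall i, ratr (pq.1 0 i) < y 0 i < ratr (pq.2 0 i)].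

Lemma open_rational_box n (pq : 'rV[rat]_n * 'rV[rat]_n) :
  open (rational_box pq).
Proof.
rewrite openE => y pqy.
exists (fun i j => `]ratr (pq.1 0 j), ratr (pq.2 0 j)[%classic).
  by move=> i j; apply: near_in_itvoo; rewrite in_itv /= ord1.
by move=> z pqz i; have := pqz 0 i; rewrite /= in_itv.
Qed.

Lemma rV_second_countable n : @second_countable 'rV[R]_n.
Proof.
exists (range (@rational_box n)).
  exact: (card_le_trans (card_image_le _ _) (countableP _)).
split=> [_ [pq _ <-]|y U /nbhs_ballP[e /= e0 yeU]].
  exact: open_rational_box.
have ratI (a b : R) : a < b -> exists r : rat, a < ratr r < b.
  by move=> /rat_in_itvoo[r]; rewrite in_itv /=; exists r.
have /choice[p pP] (i : 'I_n) : exists r : rat, y 0 i - e < ratr r < y 0 i.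
  by apply: ratI; rewrite ltrBlDr ltrDl.
have /choice[q qP] (i : 'I_n) : exists r : rat, y 0 i < ratr r < y 0 i + e.
  by apply: ratI; rewrite ltrDl.
exists (rational_box (\row_i p i, \row_i q i)).
  split; first by eexists.
  move=> i; rewrite !mxE.
  by have /andP[_ ->] := pP i; have /andP[-> _] := qP i.
move=> z zpq; apply: yeU; split=> // i j; rewrite ord1 -ball_normE /= ltr_norml.
have /andP[] := zpq j; rewrite !mxE.
by have /andP[] := pP j; have /andP[] := qP j; lra.
Qed.

Lemma is_manifold_open n (V : set 'rV[R]_n) :
  open V -> is_manifold (open_manifold V).
Proof.
move=> oV; split.
- exact/set_type_hausdorff/norm_hausdorff.
- exact/set_type_second_countable/rV_second_countable.
- move=> _ ->; split=> /=.
  + exact: openT.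
  + by apply: continuous_subspaceT; exact: initial_continuous.
  + by move=> x y _ _ /val_inj.
  + move=> _ [W oW <-] _.
    rewrite (_ : [set _ | _ in _] = W `&` V); first exact: openI.
    apply/seteqP; split=> [_ [x Wx <-]|x [Wx Vx]].
      by split=> //; exact: set_valP.
    by exists (SigSub (mem_set Vx)).
- by move=> x; eexists; first by [].
- move=> _ _ -> ->; exists id => //= ? ? i; exact: analytic_at_coord.
Qed.

End OpenManifold.

(** * Projections of relatively compact semianalytic sets *)

Section CompactProjections.
Context {R : realType}.
Implicit Types L M N : manifold_data R.

(** The projection to [M] of a relatively compact semianalytic subset of a
    product [M * N]. *)
Definition semianalytic_projection M (S : set M) : Prop :=
  exists (N : manifold_data R) (B : set (prod_manifold M N)),
    [/\ is_manifold N, semianalytic B, compact (closure B) & S = fst @` B].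

Lemma is_manifold_hausdorff M : is_manifold M -> hausdorff_space M.
Proof. by case. Qed.

Lemma semianalytic_projection_intro M N (B K : set (prod_manifold M N)) :
  is_manifold M -> is_manifold N -> semianalytic B -> compact K -> B `<=` K ->
  semianalytic_projection (fst @` B).
Proof.
move=> mM mN sB cK BK; exists N, B; split=> //.
have hMN := is_manifold_hausdorff (is_manifold_prod mM mN).
exact: compact_closure_sub hMN cK BK.
Qed.

Lemma semianalytic_projection0 M : is_manifold M ->
  semianalytic_projection (@set0 M).
Proof.
move=> mM; exists M, set0; split=> //; first exact: semianalytic0.
  by rewrite closure0; exact: compact0.
by rewrite image_set0.
Qed.

(** The transform of the subset [A] of [M] by the relation [S] in [N * M]. With
    [S = fst @` B] and [A = fst @` C], it is the projection of the fiber product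
    of [B] and [C] over [M], with parameters in [M * (N1 * N2)]. *)
Lemma semianalytic_projection_comp M N (S : set (prod_manifold N M))
    (A : set M) :
  is_manifold M -> is_manifold N ->
  semianalytic_projection S -> semianalytic_projection A ->
  semianalytic_projection [set y | exists2 x, A x & S (y, x)].
Proof.
move=> mM mN [N1 [B [mN1 sB cB SB]]] [N2 [C [mN2 sC cC AC]]].
pose L := prod_manifold N (prod_manifold M (prod_manifold N1 N2)).
pose p (w : L) : prod_manifold (prod_manifold N M) N1 :=
  ((w.1, w.2.1), w.2.2.1).
pose q (w : L) : prod_manifold M N2 := (w.2.1, w.2.2.2).
have mp : coordinate_map p.
  have := coordinate_map_comp (coordinate_map_prod (coordinate_map_id N)
    (coordinate_map_prod (coordinate_map_id M) (coordinate_map_fst N1 N2)))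
    (coordinate_map_assoc N M N1).
  exact.
have mq : coordinate_map q.
  have := coordinate_map_comp
    (coordinate_map_snd N (prod_manifold M (prod_manifold N1 N2)))
    (coordinate_map_prod (coordinate_map_id M) (coordinate_map_snd N1 N2)).
  exact.
pose k (w : prod_manifold (prod_manifold (prod_manifold N M) N1)
    (prod_manifold M N2)) : L := (w.1.1.1, (w.1.1.2, (w.1.2, w.2.2))).
have ck : continuous k.
  have cid := fun T : topologicalType => (fun x => cvg_id) : continuous (@id T).
  by repeat (apply: continuous_pair || apply: continuous_fst_comp ||
             apply: continuous_snd_comp || exact: cid).
have cK : compact (k @` (closure B `*` closure C)).
  apply: continuous_compact; last exact: compact_setX.
  exact: continuous_subspaceT.
rewrite (_ : [set _ | _] = fst @` (p @^-1` B `&` q @^-1` C)); last first.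
  apply/seteqP; split=> [y [x + +]|_ [[y [x [n1 n2]]] [/= Bp Cq] <-]].
    rewrite SB AC => -[[x' n2] /= Cx xE] [[[y' x''] n1] /= Bx [<- x'E]].
    by exists (y', (x'', (n1, n2))) => //; split=> //; rewrite /q /= x'E -xE.
  by exists x; [rewrite AC; exists (x, n2)|rewrite SB; exists ((y, x), n1)].
apply: semianalytic_projection_intro cK _ => //.
- by do 2!apply: is_manifold_prod => //.
- by apply: semianalyticI; exact: semianalytic_preimage.
move=> [y [x [n1 n2]]] [/= /subset_closure Bp /subset_closure Cq].
by exists (((y, x), n1), (x, n2)).
Qed.

Lemma semianalytic_projection_swap M N (S : set (prod_manifold M N)) :
  is_manifold M -> is_manifold N -> semianalytic_projection S ->
  semianalytic_projection ([set p | S (p.2, p.1)] : set (prod_manifold N M)).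
Proof.
move=> mM mN [L [B [mL sB cB SB]]].
pose p (w : prod_manifold (prod_manifold N M) L) :
  prod_manifold (prod_manifold M N) L := ((w.1.2, w.1.1), w.2).
pose k (w : prod_manifold (prod_manifold M N) L) :
  prod_manifold (prod_manifold N M) L := ((w.1.2, w.1.1), w.2).
have mp : coordinate_map p.
  exact: (coordinate_map_prod (coordinate_map_swap N M) (coordinate_map_id L)).
have [ck _] : coordinate_map k.
  exact: (coordinate_map_prod (coordinate_map_swap M N) (coordinate_map_id L)).
have cK : compact (k @` closure B).
  by apply: continuous_compact => //; exact: continuous_subspaceT.
rewrite (_ : [set _ | _] = fst @` (p @^-1` B)); last first.
  apply/seteqP; split=> [[y x]|_ [[[y x] l] /= Bp <-]]; rewrite /= SB.
    by move=> -[[[x' y'] l] /= Bl [<- <-]]; exists ((y', x'), l).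
  by exists ((x, y), l).
apply: semianalytic_projection_intro cK _ => //; first exact: is_manifold_prod.
  exact: semianalytic_preimage.
by move=> [[y x] l] /= /subset_closure Bp; exists ((x, y), l).
Qed.

(** If [S] and [T] are the projections of [B] and [C], then their union is the
    projection of the union of [B * C] and of [C * B], both seen in
    [M * (N1 * (M * N2))]; this requires [B] and [C] to be nonempty. *)
Lemma semianalytic_projectionU M (S T : set M) : is_manifold M ->
  semianalytic_projection S -> semianalytic_projection T ->
  semianalytic_projection (S `|` T).
Proof.
move=> mM pS pT; have [N1 [B [mN1 sB cB SB]]] := pS.
have [N2 [C [mN2 sC cC TC]]] := pT.
have [[[b1 b2] Bb]|B0] := pselect (B !=set0); last first.
  have -> : S = set0.
    by rewrite SB; apply/seteqP; split=> // x [b Bb ?]; apply: B0; exists b.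
  by rewrite set0U.
have [[[c1 c2] Cc]|C0] := pselect (C !=set0); last first.
  have -> : T = set0.
    by rewrite TC; apply/seteqP; split=> // x [c Cc ?]; apply: C0; exists c.
  by rewrite setU0.
pose L := prod_manifold M (prod_manifold N1 (prod_manifold M N2)).
pose p1 (w : L) : prod_manifold M N1 := (w.1, w.2.1).
pose p2 (w : L) : prod_manifold M N2 := w.2.2.
pose q1 (w : L) : prod_manifold M N2 := (w.1, w.2.2.2).
pose q2 (w : L) : prod_manifold M N1 := (w.2.2.1, w.2.1).
have mp1 : coordinate_map p1.
  exact: (coordinate_map_prod (coordinate_map_id M) (coordinate_map_fst _ _)).
have mp2 : coordinate_map p2.
  exact: (coordinate_map_comp (coordinate_map_snd _ _)
    (coordinate_map_snd _ _)).
have mq1 : coordinate_map q1.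
  exact: (coordinate_map_prod (coordinate_map_id M)
    (coordinate_map_comp (coordinate_map_snd _ _) (coordinate_map_snd _ _))).
have mq2 : coordinate_map q2.
  have := coordinate_map_comp (coordinate_map_snd M _) (coordinate_map_comp
    (coordinate_map_swap N1 (prod_manifold M N2))
    (coordinate_map_prod (coordinate_map_fst M N2) (coordinate_map_id N1))).
  exact.
have cid := fun X : topologicalType => (fun x => cvg_id) : continuous (@id X).
pose k (w : prod_manifold (prod_manifold M N1) (prod_manifold M N2)) : L :=
  (w.1.1, (w.1.2, (w.2.1, w.2.2))).
pose h (w : prod_manifold (prod_manifold M N1) (prod_manifold M N2)) : L :=
  (w.2.1, (w.1.2, (w.1.1, w.2.2))).
have cK : compact (k @` (closure B `*` closure C) `|`
                   h @` (closure B `*` closure C)).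
  apply: compactU; (apply: continuous_compact; last exact: compact_setX);
    apply: continuous_subspaceT;
    by repeat (apply: continuous_pair || apply: continuous_fst_comp ||
               apply: continuous_snd_comp || exact: cid).
rewrite (_ : S `|` T = fst @` ((p1 @^-1` B `&` p2 @^-1` C) `|`
                              (q1 @^-1` C `&` q2 @^-1` B))); last first.
  rewrite SB TC; apply/seteqP; split=> [_ [[[x n] /= Bx <-]|[[x n] /= Bx <-]]|].
  - by exists (x, (n, (c1, c2))) => //; left.
  - by exists (x, (b2, (b1, n))) => //; right.
  move=> _ [[x [n1 [x' n2]]] /= BC <-]; case: BC => -[/= ? _]; [left|right].
    by exists (x, n1).
  by exists (x, n2).
apply: semianalytic_projection_intro cK _ => //.
- by do 2!apply: is_manifold_prod => //.
- by apply: semianalyticU; apply: semianalyticI; exact: semianalytic_preimage.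
move=> [x [n1 [x' n2]]] [] [/= /subset_closure ? /subset_closure ?];
  [left|right].
  by exists ((x, n1), (x', n2)).
by exists ((x', n1), (x, n2)).
Qed.

End CompactProjections.

(** * Local form of subanalyticity *)

Section SubanalyticAt.
Context {R : realType}.
Implicit Types M N : manifold_data R.

Lemma semianalytic_projection_bigU M (I : eqType) (s : seq I) (S : I -> set M) :
  is_manifold M -> (forall i, semianalytic_projection (S i)) ->
  semianalytic_projection [set x | exists2 i, i \in s & S i x].
Proof.
move=> mM pS; elim: s => [|i s IHs].
  rewrite (_ : [set _ | _] = set0); first exact: semianalytic_projection0.
  by apply/seteqP; split=> // x [].
rewrite (_ : [set _ | _] = S i `|` [set x | exists2 i, i \in s & S i x]).
  exact: semianalytic_projectionU.
apply/seteqP; split=> x /=.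
  by move=> [j /[!inE] /orP[/eqP ->|js] Sj]; [left|right; exists j].
move=> [Si|[j js Sj]]; first by exists i; rewrite ?mem_head.
by exists j; rewrite ?inE ?js ?orbT.
Qed.

(** The local form of subanalyticity: near [x], the set [A] coincides with a
    semianalytic projection that is contained in [A]. *)
Definition subanalytic_at M (A : set M) (x : M) : Prop :=
  exists S : set M, [/\ semianalytic_projection S, S `<=` A &
                        \forall y \near x, A y -> S y].

Lemma subanalyticP M (A : set M) :
  subanalytic A <-> forall x, subanalytic_at A x.
Proof.
split=> sA x.
  have [U xU [N [B [mN sB cB AUB]]]] := sA x.
  exists (A `&` U); split=> [|y []//|]; first by exists N, B.
  by apply: filterS xU => y Uy Ay; split.
have [S [[N [B [mN sB cB SB]]] SA xS]] := sA x.
(* On this neighborhood, [A] is exactly [S]. *)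
exists [set y | A y -> S y] => //; exists N, B; split=> //; rewrite -SB.
by apply/seteqP; split=> y /= => [[Ay /(_ Ay)]|Sy] //; split=> //; exact: SA.
Qed.

End SubanalyticAt.

(** * Analytic equations and cubes *)

Section AnalyticSubsets.
Context {R : realType}.

Lemma analytic_map_function n m (V : set 'rV[R]_n) (W : set 'rV[R]_m)
    (f : V -> W) (i : 'I_m) : analytic_map f ->
  @analytic_function R (open_manifold V) setT (fun x => set_val (f x) 0 i).
Proof.
move=> [g gan gf] _ ->; exists (fun y => g y 0 i) => /= x _ _.
  2: by rewrite gf.
by apply: gan; exact: set_valP.
Qed.

Lemma semianalytic_equalizer (P : manifold_data R) n1 n2 m
    (V1 : set 'rV[R]_n1) (V2 : set 'rV[R]_n2) (W : set 'rV[R]_m)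
    (p : P -> open_manifold V1) (q : P -> open_manifold V2)
    (f : V1 -> W) (g : V2 -> W) :
  coordinate_map p -> coordinate_map q -> analytic_map f -> analytic_map g ->
  semianalytic [set x | f (p x) = g (q x)].
Proof.
move=> cp cq af ag.
pose F (i : 'I_m) (x : P) := set_val (f (p x)) 0 i.
pose G (i : 'I_m) (x : P) := set_val (g (q x)) 0 i.
have aF i : analytic_function setT (F i).
  exact: (analytic_function_comp cp (analytic_map_function i af)).
have aG i : analytic_function setT (G i).
  exact: (analytic_function_comp cq (analytic_map_function i ag)).
rewrite (_ : [set _ | _] = [set x | forall i, F i x - G i x <= 0] `&`
                           [set x | forall i, G i x - F i x <= 0]).
  by apply: semianalyticI; apply: semianalytic_forall_le0 => i;
     exact: analytic_functionB.
apply/seteqP; split=> x /=.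
  by move=> fg; split=> i; rewrite /F /G fg subrr.
move=> [FG GF]; apply/val_inj/rowP => i.
have := FG i; have := GF i; rewrite !subr_le0 => ? ?.
by apply/eqP; rewrite eq_le; apply/andP.
Qed.

(** The points of an open subset of Euclidean space have compact semianalytic
    neighborhoods, namely closed cubes. *)
Lemma compact_semianalytic_nbhs n (V : set 'rV[R]_n) (v : open_manifold V) :
  open V -> exists K : set (open_manifold V),
    [/\ nbhs v K, compact K & semianalytic K].
Proof.
move=> oV; have Vv : V (set_val v) by exact: set_valP.
have [e /= e0 veV] : nbhs_ball (set_val v) V.
  by apply/nbhs_ballP; exact: open_nbhs_nbhs.
pose r := e / 2; have r0 : 0 < r by rewrite divr_gt0.
pose C := [set y : 'rV[R]_n | forall i, `|set_val v 0 i - y 0 i| <= r].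
have CV : C `<=` V.
  move=> y Cy; apply: veV; split=> // i j; rewrite ord1 -ball_normE /=.
  by rewrite (le_lt_trans (Cy j)) // /r ltr_pdivrMr // ltr_pMr // ltr1n.
have cC : compact C.
  pose J i := `[set_val v 0 i - r, set_val v 0 i + r]%classic.
  rewrite (_ : C = [set y : 'rV[R]_n | forall i, J i (y 0 i)]).
    by apply: rV_compact => i; exact: segment_compact.
  apply/seteqP; split=> y /= Cy i; have := Cy i;
    by rewrite /J /= in_itv /= -ler_distlC.
exists (set_val @^-1` C : set V); split.
- have : nbhs (set_val v) C.
    apply/nbhs_ballP; exists r => //= y [_ vy] i.
    by have := vy 0 i; rewrite -ball_normE /= => /ltW.
  exact: (@initial_continuous V _ set_val v).
- move=> F PF FC.
  have FF : ProperFilter (set_val @ F) by exact: fmap_proper_filter.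
  have [y [Cy Fy]] := cC _ FF FC.
  exists (SigSub (mem_set (CV y Cy))); split; first by [].
  move=> A B FA [_ [[U oU <-] Uy] UB].
  have FA' : F (set_val @^-1` (set_val @` A : set 'rV[R]_n)).
    by apply: filterS FA => z Az; exists z.
  have [x [[z Az zx] Ux]] := Fy _ U FA' (open_nbhs_nbhs (conj oU Uy)).
  by exists z; split=> //; apply: UB; rewrite /= zx.
- have aid : analytic_map (@id V).
    by exists id => // y _ i; exact: analytic_at_coord.
  rewrite (_ : _ @^-1` _ =
    [set x : open_manifold V |
      forall i, set_val x 0 i - (set_val v 0 i + r) <= 0] `&`
    [set x : open_manifold V |
      forall i, (set_val v 0 i - r) - set_val x 0 i <= 0]).
    by apply: semianalyticI; apply: semianalytic_forall_le0 => i;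
      apply: analytic_functionB;
      solve [exact: analytic_function_cst|exact: (analytic_map_function i aid)].
  apply/seteqP; split=> x /=.
    by move=> Cx; split=> i; have := Cx i; rewrite ler_norml; lra.
  by move=> [H1 H2] i; have := H1 i; have := H2 i; rewrite ler_norml; lra.
Qed.

End AnalyticSubsets.

(** * Orbifold charts and their changes *)

Section OrbifoldCharts.
Context {R : realType} {X : topologicalType} {n : nat}.
Implicit Types c d k : ochart R X n.

Lemma oact_nbhs c (a : ogroup c) (z : odom c) (U : set (odom c)) :
  nbhs z U -> nbhs (oact a z) (oact a @` U).
Proof.
move=> zU; have azU : nbhs (oact a^-1%g (oact a z)) U.
  by rewrite -oactM mulVg oact1.
apply: (@filterS _ (nbhs (oact a z)) _ (oact a^-1%g @^-1` U)); last first.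
  exact: (oact_continuous azU).
move=> w Uw.
by exists (oact a^-1%g w); rewrite // -oactM mulgV oact1.
Qed.

Lemma open_map_oproj c (U : set (odom c)) :
  open U -> open (@oproj _ _ _ c @` U).
Proof.
move=> oU; apply/oproj_quotient; first by move=> _ [z _ <-]; exists z.
rewrite (_ : _ @^-1` _ = \bigcup_(a in [set: ogroup c]) (oact a @^-1` U)).
  apply: bigcup_open => a _; apply: open_comp => // z _; exact: oact_continuous.
apply/seteqP; split=> [z [w Uw /oproj_orbit[a zE]]|z [a _ Uaz]].
  by exists a^-1%g => //=; rewrite zE -oactM mulVg oact1.
by exists (oact a z) => //; apply/esym/oproj_orbit; exists a.
Qed.

Lemma oproj_nbhs c (z : odom c) (U : set (odom c)) :
  nbhs z U -> nbhs (oproj z) (@oproj _ _ _ c @` U).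
Proof.
rewrite !nbhsE => -[V [oV Vz] VU].
exists (@oproj _ _ _ c @` V); last exact: image_subset.
by split; [exact: open_map_oproj|exists z].
Qed.

Lemma oproj_continuous c : continuous (@oproj _ _ _ c).
Proof.
pose p := @oproj _ _ _ c; apply/continuousP => O oO.
rewrite (_ : _ @^-1` _ = p @^-1` (O `&` range p)).
  have [+ _] := @oproj_quotient _ _ _ c _ (@subIsetr _ O (range p)).
  by apply; apply: openI => //; exact: oproj_open.
by apply/seteqP; split=> z /= => [Oz|[]//]; split=> //; exists z.
Qed.

End OrbifoldCharts.

Section ChartFiberProduct.
Context {R : realType}.
Implicit Types X : orbifold R.

(** The domain of a chart, as a manifold. *)
Definition chart_manifold X (c : ochart R X (orbdim X)) : manifold_data R :=
  open_manifold (odom c).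

Lemma is_manifold_chart X (c : ochart R X (orbdim X)) :
  is_manifold (chart_manifold c).
Proof. exact/is_manifold_open/odom_open. Qed.

(** The translates by [a] and [b] of the two images of the points of [K]. The set
    of the [((z, v), w)] over the pairs [(z, v)] is defined by the equations
    [oact a^-1 z = m w] and [oact b^-1 v = l w] rather than [z = oact a (m w)]
    and [v = oact b (l w)]: this dispenses with the analyticity of composite
    maps. *)
Lemma semianalytic_projection_chart_pairs X (c d k : ochart R X (orbdim X))
    (m : odom k -> odom c) (l : odom k -> odom d) (a : ogroup c) (b : ogroup d)
    (K : set (chart_manifold k)) :
  oatlas X c -> oatlas X d -> continuous m -> continuous l ->
  analytic_map m -> analytic_map l ->
  compact K -> semianalytic K ->
  @semianalytic_projection R
    (prod_manifold (chart_manifold c) (chart_manifold d))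
    [set p | exists2 w, K w & p = (oact a (m w), oact b (l w))].
Proof.
move=> Xc Xd cm cl am al cK sK.
pose Mc := chart_manifold c; pose Md := chart_manifold d.
pose Mk := chart_manifold k.
pose P := prod_manifold (prod_manifold Mc Md) Mk.
pose pc (x : P) : Mc := x.1.1; pose pd (x : P) : Md := x.1.2.
pose pk (x : P) : Mk := x.2.
have cpk : coordinate_map pk by exact: coordinate_map_snd.
have cpc : coordinate_map pc.
  exact: (coordinate_map_comp (coordinate_map_fst _ _)
    (coordinate_map_fst _ _)).
have cpd : coordinate_map pd.
  exact: (coordinate_map_comp (coordinate_map_fst _ _)
    (coordinate_map_snd _ _)).
have [aact _ _] := oatlas_analytic X.
pose B : set P := pk @^-1` K `&` ([set x | oact a^-1%g (pc x) = m (pk x)] `&`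
                                  [set x | oact b^-1%g (pd x) = l (pk x)]).
pose h (w : Mk) : P := ((oact a (m w), oact b (l w)), w).
have ch : continuous h.
  apply: continuous_pair; last by move=> w; exact: cvg_id.
  apply: continuous_pair => w.
    by apply: continuous_comp; [exact: cm|exact: oact_continuous].
  by apply: continuous_comp; [exact: cl|exact: oact_continuous].
have sB : semianalytic B.
  apply: semianalyticI; first exact: semianalytic_preimage.
  apply: semianalyticI.
    by apply: semianalytic_equalizer => //; exact: aact.
  by apply: semianalytic_equalizer => //; exact: aact.
have BK : B `<=` h @` K.
  move=> [[z v] w] [/= Kw [zw vw]]; exists w => //.
  rewrite /h; move: zw vw; rewrite /pc /pd /pk /= => <- <-.
  by rewrite -!oactM !mulgV !oact1.
rewrite (_ : [set _ | _] = fst @` B); last first.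
  apply/seteqP; split=> [_ [w Kw ->]|_ [x Bx <-]].
    exists (h w) => //; split=> //=; split; rewrite /pc /pd /pk /=.
      by rewrite -oactM mulVg oact1.
    by rewrite -oactM mulVg oact1.
  by have [w Kw <-] := BK _ Bx; exists w.
apply: semianalytic_projection_intro BK => //.
- by apply: is_manifold_prod; exact: is_manifold_chart.
- exact: is_manifold_chart.
by apply: continuous_compact => //; exact: continuous_subspaceT.
Qed.

Lemma subanalytic_chart_fiber_product X (c d : ochart R X (orbdim X)) :
  oatlas X c -> oatlas X d ->
  @subanalytic R (prod_manifold (chart_manifold c) (chart_manifold d))
    [set p | oproj p.1 = oproj p.2].
Proof.
move=> Xc Xd; apply/subanalyticP => -[z v].
have mcd := is_manifold_prod (is_manifold_chart c) (is_manifold_chart d).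
have [zv|zv] := pselect (oproj z = oproj v); last first.
  exists set0; split=> //; first exact: semianalytic_projection0.
  have := @ospace_hausdorff _ X.
  rewrite open_hausdorff => /(_ (oproj z) (oproj v)).
  case; first exact/eqP.
  move=> [A B] [/= /set_mem Az /set_mem Bv] [oA oB AB0].
  have zA : nbhs z (@oproj _ _ _ c @^-1` A).
    by apply: oproj_continuous; exact: open_nbhs_nbhs.
  have vB : nbhs v (@oproj _ _ _ d @^-1` B).
    by apply: oproj_continuous; exact: open_nbhs_nbhs.
  exists (@oproj _ _ _ c @^-1` A, @oproj _ _ _ d @^-1` B) => //.
  move=> [z' v'] [/= Az' Bv'] zv'.
  have : (A `&` B) (oproj z') by split; [exact: Az'|rewrite zv'].
  by rewrite (eqP AB0).
have [_ _ Xchart] := oatlas_analytic X.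
have [k [Xk [w _ wz] _ [m [hm [em am]]] [l [hl [el al]]]]] :
    exists k, [/\ oatlas X k, oimage k (oproj z),
                  oimage k `<=` oimage c `&` oimage d,
                  embeds k c & embeds k d].
  by apply: Xchart => //; [exists z|exists v].
have [_ _ tm _ mproj] := em; have [_ _ tl _ lproj] := el.
have [cm _ _] := tm; have [cl _ _] := tl.
have [mm om _] := am; have [ll ol _] := al.
have [a zE] : exists a, z = oact a (m w).
  by apply/oproj_orbit; rewrite mproj wz.
have [K [wK cK sK]] :=
  @compact_semianalytic_nbhs R _ (odom k) w (@odom_open _ _ _ k).
exists [set p | exists2 b, b \in enum (ogroup d) &
  exists2 u, K u & p = (oact a (m u), oact b (l u))]; split.
- apply: semianalytic_projection_bigU => // b.
  exact: semianalytic_projection_chart_pairs.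
- move=> _ [b _ [u Ku ->]] /=.
  transitivity (oproj u).
    by rewrite -mproj; apply/esym/oproj_orbit; exists a.
  by rewrite -lproj; apply/oproj_orbit; exists b.
(* Near [z], every point is [oact a (m u)] for some [u] in [K]; a point [v'] with
   the same image as [u] in [X] lies in the orbit of [l u]. *)
have zK : nbhs z (oact a @` (m @` K)).
  by rewrite zE; apply: oact_nbhs; exact: embedding_nbhs.
exists (oact a @` (m @` K), setT); first by split=> //; exact: filterT.
move=> [z' v'] [/= [_ [u Ku <-] <-] _] zv'.
have [b v'E] : exists b, v' = oact b (l u).
  apply/oproj_orbit; rewrite lproj -mproj -zv'; apply/oproj_orbit; by exists a.
by exists b; [rewrite mem_enum|exists u => //; rewrite v'E].
Qed.

End ChartFiberProduct.

(** * Subanalytic sets in orbifold charts *)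

Section SubanalyticCharts.
Context {R : realType}.

(** [D] is subanalytic at [y] if it contains the transform of [A] by the relation
    [S] and if, close to [y], each of its points is related to a point of [A]
    close to [x]. *)
Lemma subanalytic_at_transform (M N : manifold_data R)
    (S : set (prod_manifold N M)) (A : set M) (D : set N) (y : N) (x : M) :
  is_manifold M -> is_manifold N -> subanalytic S -> subanalytic A ->
  (forall y' x', A x' -> S (y', x') -> D y') ->
  (forall W, nbhs x W ->
     \forall y' \near y, D y' -> exists x', [/\ W x', A x' & S (y', x')]) ->
  subanalytic_at D y.
Proof.
move=> mM mN /subanalyticP sS /subanalyticP sA SAD near_y.
have [S1 [pS1 S1S [[Q W] [/= yQ xW] QWS]]] := sS (y, x).
have [A1 [pA1 A1A xA]] := sA x.
exists [set y' | exists2 x', A1 x' & S1 (y', x')]; split.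
- exact: semianalytic_projection_comp.
- by move=> y' [x' /A1A Ax' /S1S Sx']; exact: SAD Sx'.
apply: filterS2 yQ (near_y _ (filterI xW xA)) => y' Qy' yD Dy'.
have [x' [[Wx' xA1] Ax' Sx']] := yD Dy'.
by exists x'; [exact: xA1|exact: (QWS (y', x'))].
Qed.

Context (X : orbifold R).

(** A subanalytic subset of an orbifold is subanalytic in every chart. *)
Lemma osubanalytic_chart (B : set X) (d : ochart R X (orbdim X)) :
  oatlas X d -> osubanalytic B ->
  @subanalytic R (chart_manifold d) (@oproj _ _ _ d @^-1` B).
Proof.
move=> Xd sB; apply/subanalyticP => z.
have [e [Xe [v _ vz] sBe]] := sB (oproj z).
have eE : @oproj _ _ _ e @^-1` (B `&` oimage e) = @oproj _ _ _ e @^-1` B.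
  by apply/seteqP; split=> u /= => [[]//|Bu]; split=> //; exists u.
rewrite eE in sBe.
apply: (@subanalytic_at_transform (chart_manifold e) (chart_manifold d)
  [set p | oproj p.1 = oproj p.2] (@oproj _ _ _ e @^-1` B) _ z v).
- exact: is_manifold_chart.
- exact: is_manifold_chart.
- exact: subanalytic_chart_fiber_product.
- exact: sBe.
- by move=> z' v' /= Bv' ->.
move=> W /oproj_nbhs; rewrite vz => vW.
have zW := @oproj_continuous _ _ _ d z _ vW.
apply: (@filterS _ (nbhs z)) zW => z' /= [v' Wv' v'z'] Bz'.
by exists v'; split=> //=; rewrite v'z'.
Qed.

Lemma osubanalytic_of_charts (B : set X) :
  (forall x : X, exists c, [/\ oatlas X c, oimage c x &
     @subanalytic R (chart_manifold c) (@oproj _ _ _ c @^-1` B)]) ->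
  osubanalytic B.
Proof.
move=> sB x; have [c [Xc cx sBc]] := sB x; exists c; split=> //.
rewrite (_ : _ @^-1` _ = @oproj _ _ _ c @^-1` B) //.
by apply/seteqP; split=> u /= => [[]//|Bu]; split=> //; exists u.
Qed.

End SubanalyticCharts.

(** * Images and inverse images under subanalytic maps *)

Section SubanalyticMaps.
Context {R : realType} {X Y : orbifold R} (f : X -> Y).
Context (hf : osubanalytic_map f).

Lemma osubanalytic_map_continuous : continuous f.
Proof.
move=> x U fxU.
have [c [d [[_ _ [u _ ux] _ _] [_ [g [_ [cg _] _ gf]]]]]] := hf x.
have gU : nbhs (g u) (@oproj _ _ _ d @^-1` U).
  by apply: oproj_continuous; rewrite gf ux.
have := oproj_nbhs (cg u _ gU); rewrite ux; apply: filterS.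
by move=> _ [u' /= Uu' <-]; rewrite /= -gf.
Qed.

Lemma osubanalytic_preimage (B : set Y) :
  osubanalytic B -> osubanalytic (f @^-1` B).
Proof.
move=> sB; apply: osubanalytic_of_charts => x.
have [c [d [[Xc Yd cx _ _] [_ [g [_ [cg sg] _ gf]]]]]] := hf x.
exists c; split=> //; apply/subanalyticP => z.
apply: (@subanalytic_at_transform R (chart_manifold d) (chart_manifold c)
  [set p | p.2 = g p.1] (@oproj _ _ _ d @^-1` B) _ z (g z)).
- exact: is_manifold_chart.
- exact: is_manifold_chart.
- exact: sg.
- exact: osubanalytic_chart.
- by move=> z' v /= Bv vE; rewrite -gf -vE.
move=> W gzW; apply: (@filterS _ (nbhs z)) (cg z _ gzW) => z' Wz' Bz'.
by exists (g z'); split=> //=; rewrite gf.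
Qed.

(** The set [T] contains the points close to [z] whose image in [Y] comes from a
    point of [A] close to [x]. *)
Lemma osubanalytic_image_local (A : set X) (d : ochart R Y (orbdim Y))
    (z : chart_manifold d) (x : X) :
  oatlas Y d -> osubanalytic A -> f x = oproj z ->
  exists T : set (chart_manifold d),
    [/\ semianalytic_projection T, T `<=` @oproj _ _ _ d @^-1` (f @` A) &
        \forall x' \near x & z' \near z, A x' -> f x' = oproj z' -> T z'].
Proof.
move=> Yd sA fxz.
have [c [e [[Xc Ye [u _ ux] _ _] [_ [g [_ [cg sg] _ gf]]]]]] := hf x.
have /subanalyticP/(_ (z, g u)) [S1 [pS1 S1S [[Q1 Q2] [/= zQ1 guQ2] QS1]]] :=
  subanalytic_chart_fiber_product Yd Ye.
have /subanalyticP/(_ u) [S2 [pS2 S2A uS2]] := osubanalytic_chart Xc sA.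
have /subanalyticP/(_ (u, g u)) [S3 [pS3 S3g [[Q3 Q4] [/= uQ3 guQ4] QS3]]] :=
  sg.
have mc := is_manifold_chart c; have md := is_manifold_chart d.
have me := is_manifold_chart e.
exists [set z' |
  exists2 v, [set v | exists2 u', S2 u' & S3 (u', v)] v & S1 (z', v)].
split.
- apply: semianalytic_projection_comp => //.
  apply: (@semianalytic_projection_comp R _ _ [set p | S3 (p.2, p.1)]) => //.
  exact: semianalytic_projection_swap.
- move=> z' [v [u' /S2A /= Au' /S3g /= vE] /S1S /= zv].
  by exists (oproj u') => //; rewrite zv vE gf.
pose W := Q3 `&` [set u' | A (oproj u') -> S2 u'] `&` (g @^-1` (Q2 `&` Q4)).
have uW : nbhs u W.
  by apply: filterI; [exact: filterI|apply: cg; exact: filterI].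
have := oproj_nbhs uW; rewrite ux => xW.
exists (@oproj _ _ _ c @` W, Q1) => //.
move=> [_ z'] [/= [u' [[Q3u' AS2] [Q2u' Q4u']] <-] Q1z'] Au' fz'.
exists (g u'); last by apply: (QS1 (z', g u')); rewrite //= gf fz'.
by exists u'; [exact: AS2|exact: (QS3 (u', g u'))].
Qed.

(** A neighborhood of a fiber contains the nearby fibers. As [Y] is locally
    compact at [oproj z], it is enough to consider the fibers over a compact
    neighborhood. *)
Lemma proper_fiber_nbhs (d : ochart R Y (orbdim Y)) (z : odom d) (O : set X) :
  proper_map f -> open O -> f @^-1` [set oproj z] `<=` O ->
  \forall y \near oproj z, f @^-1` [set y] `<=` O.
Proof.
move=> pf oO fzO.
have [K [zK cK _]] :=
  @compact_semianalytic_nbhs R _ (odom d) z (@odom_open _ _ _ d).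
have hX := @ospace_hausdorff _ X; have hY := @ospace_hausdorff _ Y.
have cdK : compact (@oproj _ _ _ d @` K).
  apply: continuous_compact => //; apply: continuous_subspaceT.
  exact: oproj_continuous.
pose C := f @^-1` (@oproj _ _ _ d @` K) `\` O.
have cC : compact C.
  apply: (subclosed_compact _ (pf _ cdK)); last exact: subDsetl.
  apply: closedI; last exact: open_closedC.
  exact: compact_closed (pf _ cdK).
have cfC : closed (f @` C).
  apply: compact_closed => //; apply: continuous_compact => //.
  exact/continuous_subspaceT/osubanalytic_map_continuous.
have nfC : nbhs (oproj z) (~` (f @` C)).
  apply: open_nbhs_nbhs; split; first exact: closed_openC.
  by move=> [x [_ nOx] fxz]; apply/nOx/fzO.
apply: filterS2 (oproj_nbhs zK) nfC => y Ky nCy x fxy.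
apply: contrapT => nOx; apply: nCy; exists x => //; split=> //.
by rewrite /= fxy.
Qed.

Lemma osubanalytic_image (A : set X) :
  proper_map f -> osubanalytic A -> osubanalytic (f @` A).
Proof.
move=> pf sA; apply: osubanalytic_of_charts => y0.
have [_ Ycov _] := oatlas_analytic Y.
have [d Yd dy0] := Ycov y0; exists d; split=> //; apply/subanalyticP => z.
have md := is_manifold_chart d.
(* The components of [p x] are the set given by [osubanalytic_image_local], and
   the neighborhoods of [x] and [z] where it applies; off the fiber, the first
   two are empty. *)
have /choice[p pP] (x : X) :
  exists p : set (chart_manifold d) * set X * set (chart_manifold d),
    [/\ semianalytic_projection p.1.1,
        p.1.1 `<=` @oproj _ _ _ d @^-1` (f @` A),
        open p.1.2 /\ nbhs z p.2,
        (f x = oproj z -> p.1.2 x) &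
        forall x' z',
          p.1.2 x' -> p.2 z' -> A x' -> f x' = oproj z' -> p.1.1 z'].
  have [fxz|fxz] := pselect (f x = oproj z); last first.
    exists (set0, set0, setT); split=> //=.
      exact: semianalytic_projection0.
    by split; [exact: open0|exact: filterT].
  have [T [pT TA [[U Q] [/= xO zQ] OQT]]] := osubanalytic_image_local Yd sA fxz.
  exists (T, U^°, Q); split=> //=; first by split=> //; exact: open_interior.
  move=> x' z' Ux' Qz'; apply: (OQT (x', z')); split=> //.
  exact: interior_subset.
have [s scov] : exists s : {fset X},
    f @^-1` [set oproj z] `<=` [set x' | exists2 x, x \in s & (p x).1.2 x'].
  have /compact_near_coveringP nc := pf _ (@compact_set1 Y (oproj z)).
  have [|s _ sP] := nc _ totally
    (fun s x' => exists2 x, x \in (s : {fset X}) & (p x).1.2 x') _.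
    move=> x /= fxz; have [_ _ [oOx _] /(_ fxz) Ox _] := pP x.
    exists ((p x).1.2, [set s | ([fset x] `<=` s)%fset]).
      by split; [exact: open_nbhs_nbhs|exists [fset x]%fset].
    move=> [x' s] [/= Ox' /fsubsetP xs]; exists x => //.
    by apply: xs; rewrite inE.
  by exists s; apply: sP => /=; exact: fsubset_refl.
exists [set z' | exists2 x, x \in (s : seq X) & (p x).1.1 z']; split.
- by apply: semianalytic_projection_bigU => // x; have [] := pP x.
- by move=> z' [x _]; have [_ + _ _ _] := pP x; exact.
have zQ : \forall z' \near z, forall x, x \in (s : seq X) -> (p x).2 z'.
  elim: (s : seq X) => [|x t IHt]; first by apply: filterE => z'.
  have [_ _ [_ zQ] _ _] := pP x.
  by apply: filterS2 zQ IHt => z' pz' IH x'; rewrite inE => /orP[/eqP ->|/IH].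
have oO : open [set x' | exists2 x, x \in s & (p x).1.2 x'].
  apply: (@bigcup_open _ _ [set` s] (fun x => (p x).1.2)) => x _.
  by have [_ _ []] := pP x.
have zO := @oproj_continuous _ _ _ d z _ (proper_fiber_nbhs pf oO scov).
apply: filterS2 zQ zO => z' zQ fO [x' Ax' fx'].
have [x xs Ox'] := fO x' fx'.
exists x => //; have [_ _ _ _ pT] := pP x.
exact: pT Ox' (zQ x xs) Ax' fx'.
Qed.

End SubanalyticMaps.

Theorem theorem9p3 (R : realType) (X Y : orbifold R) (f : X -> Y)
    (hf : osubanalytic_map f) :
  (forall B : set Y, osubanalytic B -> osubanalytic (f @^-1` B)) /\
  (proper_map f -> forall A : set X, osubanalytic A -> osubanalytic (f @` A)).
Proof.
split=> [B|pf A]; first exact: osubanalytic_preimage.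
exact: osubanalytic_image.
Qed.
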